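(* Let $S^1\times_c\mathrm{Diff}^+(S^1)$ be the Virasoro-Bott group with Lie algebra $\mathbb R\times_\omega\mathfrak X(S^1)$ and the right invariant weak Riemannian metric induced by the inner product $\left\langle\binom ha,\binom kb\right\rangle=\int_{S^1}hk\,dx+ab$. Let $\mathcal R$ be its Riemannian curvature in right trivialization. Then for all $\binom{h_1}{a_1},\binom{h_2}{a_2}\in\mathbb R\times_\omega\mathfrak X(S^1)$, $$\begin{aligned}&\left\langle4\mathcal R\left(\binom{h_1}{a_1},\binom{h_2}{a_2}\right)\binom{h_1}{a_1},\binom{h_2}{a_2}\right\rangle\\&=\int_{S^1}\Big(-4[h_1,h_2]^2+4(a_1h_2-a_2h_1)(h_1h_2^{(4)}-h_1'h_2'''+h_1'''h_2'-h_1^{(4)}h_2)\\&\qquad\quad-(h_2''')^2a_1^2+2h_1'''h_2'''a_1a_2-(h_1''')^2a_2^2\Big)\,dx+3\,\omega(h_1,h_2)^2 .\end{aligned}$$ In particular the sign of the sectional curvature is not constant: this expression takes both positive and negative values; for $h_1(x)=\sin x$, $h_2(x)=\cos x$ it equals $-\pi(8+a_1^2+a_2^2-3\pi)$.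
   Context: $S^1=\mathbb R/2\pi\mathbb Z$; vector fields $h\partial_x$ on $S^1$ are identified with functions $h$, and $[h,k]=h'k-hk'$. The Virasoro-Bott group is the central extension $S^1\times\mathrm{Diff}^+(S^1)$ with product $\binom\varphi\alpha\binom\psi\beta=\binom{\varphi\circ\psi}{\alpha\beta e^{2\pi ic(\varphi,\psi)}}$, where $c(\varphi,\psi)=\int_{S^1}\log(\varphi'\circ\psi)\,d\log\psi'$. Its Lie algebra is $\mathbb R\times_\omega\mathfrak X(S^1)$, with elements $\binom ha$, $h\in\mathfrak X(S^1)$, $a\in\mathbb R$, and bracket $$\left[\binom ha,\binom kb\right]=\binom{h'k-hk'}{\omega(h,k)},\qquad \omega(h,k)=\int_{S^1}h'k''\,dx$$ (the Lie algebra of the central circle being identified with $\mathbb R$ with the normalization for which the bracket has this form). The right invariant metric is obtained by right translating the inner product; right trivialization identifies each tangent space with the Lie algebra by right translation. $\mathcal R(X,Y)=[\nabla_X,\nabla_Y]-\nabla_{[X,Y]}$ is the curvature of the Levi-Civita connection $\nabla$; with $\mathrm{ad}(X)Y=[X,Y]$, $\mathrm{ad}(X)^\top$ the adjoint and $\alpha(X)Z=\mathrm{ad}(Z)^\top X$, it equals, for Lie algebra elements $X,Y$ (operator brackets being commutators), $-\tfrac14[\mathrm{ad}(X)^\top+\mathrm{ad}(X),\mathrm{ad}(Y)^\top+\mathrm{ad}(Y)]+\tfrac14[\mathrm{ad}(X)^\top-\mathrm{ad}(X),\alpha(Y)]+\tfrac14[\alpha(X),\mathrm{ad}(Y)^\top-\mathrm{ad}(Y)]+\tfrac14[\alpha(X),\alpha(Y)]+\tfrac12\alpha([X,Y])$.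 ''Sectional curvature'' here refers to the displayed quantity. *)

(* Defs.v *)
From Stdlib Require Import Reals Lra Lia ZArith.
From Coquelicot Require Import Coquelicot.
Set Implicit Arguments.
Unset Strict Implicit.
Open Scope R_scope.

(** * Smooth functions of one and two real variables *)

Definition smooth (f : R -> R) : Prop := forall n x, ex_derive_n f n x.

(** [F] is C-infinity on the plane; [D i j] is the partial derivative of [F] of
    order [i] in the first variable and [j] in the second one. *)
Definition smooth2 (F : R -> R -> R) : Prop :=
  exists D : nat -> nat -> R -> R -> R,
    (forall t x, D 0%nat 0%nat t x = F t x) /\
    (forall i j t x,
        is_derive (fun s => D i j s x) t (D (S i) j t x) /\
        is_derive (fun y => D i j t y) x (D i (S j) t x) /\
        continuity_2d_pt (D i j) t x).

Definition Ck (n : nat) (f : R -> R) : Prop :=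
  forall k x, (k <= n)%nat -> ex_derive_n f k x.

Lemma smooth_Ck f : smooth f <-> forall n, Ck n f.
Proof.
split.
- intros H n k x _; apply H.
- intros H n x; apply (H n n x); lia.
Qed.

Lemma Derive_n_Derive f n x : Derive_n (Derive f) n x = Derive_n f (S n) x.
Proof.
change (Derive f) with (Derive_n f 1).
rewrite Derive_n_comp; now replace (n + 1)%nat with (S n) by lia.
Qed.

Lemma Ck_S n f : Ck (S n) f <-> (forall x, ex_derive f x) /\ Ck n (Derive f).
Proof.
split.
- intros H; split.
  + intros x; apply (H 1%nat x); lia.
  + intros [|k] x Hk; [exact I|].
    simpl. apply ex_derive_ext with (Derive_n f (S k)).
    { intros y; symmetry; apply Derive_n_Derive. }
    apply (H (S (S k)) x); lia.
- intros [H1 H2] [|[|k]] x Hk; [exact I|apply H1|].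
  apply (ex_derive_ext (Derive_n (Derive f) k)).
  { intros y; apply Derive_n_Derive. }
  apply (H2 (S k) x); lia.
Qed.

Lemma Ck_pred n f : Ck (S n) f -> Ck n f.
Proof. intros H k x Hk; apply H; lia. Qed.

Lemma Ck_ext n f g : (forall x, f x = g x) -> Ck n f -> Ck n g.
Proof.
intros E H k x Hk; apply ex_derive_n_ext with f; [exact E|now apply H].
Qed.

Lemma Ck_0 f : Ck 0 f.
Proof. intros k x Hk; replace k with 0%nat by lia; exact I. Qed.

Lemma Ck_plus n f g : Ck n f -> Ck n g -> Ck n (fun x => f x + g x).
Proof.
revert f g; induction n as [|n IH]; intros f g Hf Hg; [apply Ck_0|].
apply Ck_S in Hf; apply Ck_S in Hg; destruct Hf as [f1 f2], Hg as [g1 g2].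
apply Ck_S; split.
- intros x; apply @ex_derive_plus; auto.
- apply Ck_ext with (fun x => Derive f x + Derive g x); [|now apply IH].
  intros x; symmetry; now apply Derive_plus.
Qed.

Lemma Ck_mult n f g : Ck n f -> Ck n g -> Ck n (fun x => f x * g x).
Proof.
revert f g; induction n as [|n IH]; intros f g Hf Hg; [apply Ck_0|].
pose proof (Ck_pred Hf) as Hf'; pose proof (Ck_pred Hg) as Hg'.
apply Ck_S in Hf; apply Ck_S in Hg; destruct Hf as [f1 f2], Hg as [g1 g2].
apply Ck_S; split.
- intros x; apply ex_derive_mult; auto.
- apply Ck_ext with (fun x => Derive f x * g x + f x * Derive g x).
  + intros x; symmetry; now apply Derive_mult.
  + apply Ck_plus; now apply IH.
Qed.

Lemma Ck_comp n f g : Ck n f -> Ck n g -> Ck n (fun x => f (g x)).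
Proof.
revert f g; induction n as [|n IH]; intros f g Hf Hg; [apply Ck_0|].
pose proof (Ck_pred Hg) as Hg'.
apply Ck_S in Hf; apply Ck_S in Hg; destruct Hf as [f1 f2], Hg as [g1 g2].
apply Ck_S; split.
- intros x; apply (@ex_derive_comp _ _ f g); auto.
- apply Ck_ext with (fun x => Derive g x * Derive f (g x)).
  + intros x; symmetry; now apply Derive_comp.
  + apply Ck_mult; auto.
Qed.

Lemma Ck_const n (c : R) : Ck n (fun _ => c).
Proof.
revert c; induction n as [|n IH]; intros c; [apply Ck_0|].
apply Ck_S; split.
- intros x; apply ex_derive_const.
- apply Ck_ext with (fun _ => 0); [|apply IH].
  intros x; symmetry; apply Derive_const.
Qed.

Lemma Ck_id n : Ck n (fun x => x).
Proof.
destruct n as [|n]; [apply Ck_0|]; apply Ck_S; split.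
- intros x; apply ex_derive_id.
- apply Ck_ext with (fun _ => 1); [|apply Ck_const].
  intros x; symmetry; apply Derive_id.
Qed.

Lemma Ck_sin_cos n : Ck n sin /\ Ck n cos.
Proof.
induction n as [|n [IHs IHc]]; [split; apply Ck_0|].
split; apply Ck_S; split.
- intros x; exists (cos x); apply is_derive_sin.
- apply Ck_ext with cos; [|exact IHc].
  intros x; symmetry; apply is_derive_unique, is_derive_sin.
- intros x; exists (- sin x); apply is_derive_cos.
- apply Ck_ext with (fun x => (-1) * sin x).
  + intros x; symmetry; rewrite (is_derive_unique _ _ _ (is_derive_cos x)); ring.
  + apply Ck_mult; [apply Ck_const|exact IHs].
Qed.

Lemma smooth_plus f g : smooth f -> smooth g -> smooth (fun x => f x + g x).
Proof. rewrite !smooth_Ck; intros; now apply Ck_plus. Qed.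

Lemma smooth_scal (c : R) f : smooth f -> smooth (fun x => c * f x).
Proof.
rewrite !smooth_Ck; intros H n; apply Ck_mult; [apply Ck_const|apply H].
Qed.

Lemma smooth_comp f g : smooth f -> smooth g -> smooth (fun x => f (g x)).
Proof. rewrite !smooth_Ck; intros; now apply Ck_comp. Qed.

Lemma smooth_id : smooth (fun x => x).
Proof. apply smooth_Ck, Ck_id. Qed.

Lemma smooth_const (c : R) : smooth (fun _ => c).
Proof. apply smooth_Ck; intros n; apply Ck_const. Qed.

Lemma smooth_ex_derive f x : smooth f -> ex_derive f x.
Proof. intros H; apply (H 1%nat). Qed.

Lemma smooth2_snd f : smooth f -> smooth2 (fun _ x => f x).
Proof.
intros Hf.
exists (fun i j _ x => match i with 0%nat => Derive_n f j x | S _ => 0 end).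
split; [reflexivity|].
intros [|i] j t x; (split; [|split]); try exact (is_derive_const _ _).
- exact (Derive_correct _ _ (Hf (S j) x)).
- apply (@continuity_1d_2d_pt_comp (Derive_n f j) (fun _ y => y)).
  + apply derivable_continuous_pt, ex_derive_Reals_0, (Hf (S j)).
  + apply continuity_2d_pt_id2.
- apply continuity_2d_pt_const.
Qed.

(** * The circle R/2piZ, its vector fields and the Virasoro Lie algebra *)

Definition int_S1 (f : R -> R) : R := RInt f 0 (2 * PI).

(** The vector field [h d/dx] on the circle, as a periodic function. *)
Record vect := Vect {
  vfun :> R -> R;
  vfun_smooth : smooth vfun;
  vfun_periodic : forall x, vfun (x + 2 * PI) = vfun x }.

Program Definition vect_add (h k : vect) : vect :=
  @Vect (fun x => h x + k x) _ _.
Next Obligation. apply smooth_plus; apply vfun_smooth. Qed.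
Next Obligation. now rewrite !vfun_periodic. Qed.

Program Definition vect_scal (c : R) (h : vect) : vect :=
  @Vect (fun x => c * h x) _ _.
Next Obligation. apply smooth_scal; apply vfun_smooth. Qed.
Next Obligation. now rewrite vfun_periodic. Qed.

Program Definition vect_sin : vect := @Vect sin _ _.
Next Obligation. apply smooth_Ck; intros n; apply Ck_sin_cos. Qed.
Next Obligation. rewrite sin_plus, sin_2PI, cos_2PI; ring. Qed.

Program Definition vect_cos : vect := @Vect cos _ _.
Next Obligation. apply smooth_Ck; intros n; apply Ck_sin_cos. Qed.
Next Obligation. rewrite cos_plus, sin_2PI, cos_2PI; ring. Qed.

(** The Lie algebra bracket of the diffeomorphism group, i.e. the negative of the
    usual bracket of vector fields. *)
Definition bracket (h k : R -> R) (x : R) : R :=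
  Derive h x * k x - h x * Derive k x.

Definition omega (h k : R -> R) : R :=
  int_S1 (fun x => Derive h x * Derive_n k 2 x).

(** The pair [(h, a)] is the column vector with entries [h] and [a]. *)
Definition vir : Type := (vect * R)%type.

Definition vadd (X Y : vir) : vir := (vect_add (fst X) (fst Y), snd X + snd Y).
Definition vscal (c : R) (X : vir) : vir := (vect_scal c (fst X), c * snd X).
Definition vsub (X Y : vir) : vir := vadd X (vscal (-1) Y).

Definition inner (X Y : vir) : R :=
  int_S1 (fun x => fst X x * fst Y x) + snd X * snd Y.

(** * The Virasoro-Bott group *)

(** An orientation preserving diffeomorphism of the circle is given by a lift
    to the real line, which is unique up to a translation by a multiple of
    2 pi; see [same] below.  The central circle is the unit circle of C. *)
Record VB := mkVB {
  lift : R -> R;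
  central : C;
  lift_smooth : smooth lift;
  lift_shift : forall x, lift (x + 2 * PI) = lift x + 2 * PI;
  lift_orient : forall x, 0 < Derive lift x;
  central_unit : Cmod central = 1 }.

(** Equality in the Virasoro-Bott group: all functions on the group considered
    below are functions on [VB] which are invariant under [same]. *)
Definition same (g g' : VB) : Prop :=
  central g = central g' /\
  exists k : Z, forall x, lift g' x = lift g x + IZR k * (2 * PI).

Definition bott (phi psi : R -> R) : R :=
  int_S1 (fun x => ln (Derive phi (psi x)) * Derive (fun y => ln (Derive psi y)) x).

Definition cis (theta : R) : C := (cos theta, sin theta).

Lemma Cmod_cis theta : Cmod (cis theta) = 1.
Proof.
unfold Cmod, cis; simpl.
replace (_ + _) with (Rsqr (sin theta) + Rsqr (cos theta)) by (unfold Rsqr; ring).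
rewrite sin2_cos2; apply sqrt_1.
Qed.

Program Definition vb_mul (g1 g2 : VB) : VB :=
  @mkVB (fun x => lift g1 (lift g2 x))
        (central g1 * central g2 * cis (2 * PI * bott (lift g1) (lift g2)))%C
        _ _ _ _.
Next Obligation. apply smooth_comp; apply lift_smooth. Qed.
Next Obligation. now rewrite !lift_shift. Qed.
Next Obligation.
rewrite Derive_comp; [|apply smooth_ex_derive, lift_smooth..].
apply Rmult_lt_0_compat; apply lift_orient.
Qed.
Next Obligation. rewrite !Cmod_mult, !central_unit, Cmod_cis; ring. Qed.

Program Definition vb_one : VB := @mkVB (fun x => x) (RtoC 1) _ _ _ _.
Next Obligation. apply smooth_id. Qed.
Next Obligation. rewrite Derive_id; lra. Qed.
Next Obligation. apply Cmod_1. Qed.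

(** * Smooth curves, functions and vector fields on the group *)

Definition smooth_curve (c : R -> VB) : Prop :=
  smooth2 (fun t x => lift (c t) x) /\
  smooth (fun t => fst (central (c t))) /\
  smooth (fun t => snd (central (c t))).

(** As in convenient calculus, a function on this Frechet-Lie group is smooth
    iff it is smooth along all smooth curves. *)
Definition smooth_fun (f : VB -> R) : Prop :=
  (forall g g', same g g' -> f g = f g') /\
  (forall c, smooth_curve c -> smooth (fun t => f (c t))).

(** A smooth vector field on the group in right trivialization: [X g] stands
    for the tangent vector at [g] which is the right translate by [g] of the
    Lie algebra element [X g]. *)
Record vfield := VField {
  vf :> VB -> vir;
  vf_same : forall g g', same g g' -> vf g = vf g';
  vf_smooth : forall c, smooth_curve c ->
    smooth2 (fun t x => fst (vf (c t)) x) /\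
    smooth (fun t => snd (vf (c t))) }.

(** The right invariant vector field with value [v] at the identity. *)
Program Definition right_inv (v : vir) : vfield := @VField (fun _ => v) _ _.
Next Obligation.
split; [apply smooth2_snd, vfun_smooth|apply smooth_const].
Qed.

(** The curve [c] starts at the identity with velocity [v].  The tangent line
    of the central circle at 1 is identified with R by [a |-> 4 pi i a]: with
    the factor [e^(2 pi i c)] in the product of the group, this is the
    normalization for which the Lie bracket of the group is
    [[(h,a),(k,b)] = (h'k - hk', omega(h,k))], i.e. for which the right
    invariant fields satisfy
    [[right_inv X, right_inv Y] = - right_inv [X,Y]]. *)
Definition starts_with_velocity (c : R -> VB) (v : vir) : Prop :=
  smooth_curve c /\ c 0 = vb_one /\
  (forall x, is_derive (fun t => lift (c t) x) 0 (fst v x)) /\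
  is_derive (fun t => fst (central (c t))) 0 0 /\
  is_derive (fun t => snd (central (c t))) 0 (4 * PI * snd v).

(** The derivative of [f] at [g] along the right translate of [v] is [l]. *)
Definition is_dir_derive (f : VB -> R) (g : VB) (v : vir) (l : R) : Prop :=
  forall c, starts_with_velocity c v -> is_derive (fun t => f (vb_mul (c t) g)) 0 l.

(** [F] is the derivative [X f]. *)
Definition is_lie_derive (X : vfield) (f F : VB -> R) : Prop :=
  forall g, is_dir_derive f g (X g) (F g).

(** [brk] is the Lie bracket of vector fields: [[X,Y] f = X (Y f) - Y (X f)]. *)
Definition is_field_bracket (brk : vfield -> vfield -> vfield) : Prop :=
  forall (X Y : vfield) (f Xf Yf XYf YXf : VB -> R),
    smooth_fun f ->
    is_lie_derive X f Xf -> is_lie_derive Y f Yf ->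
    is_lie_derive X Yf XYf -> is_lie_derive Y Xf YXf ->
    is_lie_derive (brk X Y) f (fun g => XYf g - YXf g).

(** * The Levi-Civita connection and the curvature *)

(** The right invariant metric; right translations being isometries, it is
    [inner] in right trivialization. *)
Definition metric (X Y : vfield) (g : VB) : R := inner (X g) (Y g).

Record is_connection (nabla : vfield -> vfield -> vfield) : Prop := {
  connection_linear : forall (f1 f2 : VB -> R) (X1 X2 X Y : vfield),
    smooth_fun f1 -> smooth_fun f2 ->
    (forall g, X g = vadd (vscal (f1 g) (X1 g)) (vscal (f2 g) (X2 g))) ->
    forall g, nabla X Y g =
      vadd (vscal (f1 g) (nabla X1 Y g)) (vscal (f2 g) (nabla X2 Y g));
  connection_additive : forall X Y1 Y2 Y : vfield,
    (forall g, Y g = vadd (Y1 g) (Y2 g)) ->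
    forall g, nabla X Y g = vadd (nabla X Y1 g) (nabla X Y2 g);
  connection_Leibniz : forall (f Xf : VB -> R) (X Y fY : vfield),
    smooth_fun f -> is_lie_derive X f Xf ->
    (forall g, fY g = vscal (f g) (Y g)) ->
    forall g, nabla X fY g =
      vadd (vscal (f g) (nabla X Y g)) (vscal (Xf g) (Y g)) }.

Record is_levi_civita (brk nabla : vfield -> vfield -> vfield) : Prop := {
  levi_civita_connection : is_connection nabla;
  levi_civita_torsion_free : forall X Y g,
    vsub (nabla X Y g) (nabla Y X g) = brk X Y g;
  levi_civita_metric : forall X Y Z,
    is_lie_derive X (metric Y Z)
      (fun g => metric (nabla X Y) Z g + metric Y (nabla X Z) g) }.

Definition curvature (brk nabla : vfield -> vfield -> vfield)
    (X Y Z : vfield) (g : VB) : vir :=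
  vsub (vsub (nabla X (nabla Y Z) g) (nabla Y (nabla X Z) g))
       (nabla (brk X Y) Z g).

(** The curvature in right trivialization, evaluated at the point [g] on the
    Lie algebra elements [X], [Y], [Z]. *)
Definition right_triv_curvature (brk nabla : vfield -> vfield -> vfield)
    (g : VB) (X Y Z : vir) : vir :=
  curvature brk nabla (right_inv X) (right_inv Y) (right_inv Z) g.

(* Main.v *)
Require Import Defs.
From Stdlib Require Import Reals Lra Lia ZArith.
From Stdlib Require Import FunctionalExtensionality ProofIrrelevance.
From Coquelicot Require Import Coquelicot.
Open Scope R_scope.

(** For right invariant fields everything is algebra in the Virasoro algebra,
    once the bracket of two such fields is known.

    The bracket of the fields with values [X] and [Y] is the right invariant field
    with value [-[X,Y]] ([bracket_right_inv]).  It is read off from two families of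
    test functions that separate tangent vectors.  The functions
    [g |-> p (lift g x)], with [p] periodic, see the vector field part: a field [h]
    sends such a function to the one with [h p'] in place of [p].  The linear forms
    in the central coordinate see the central part: along the right translate of
    [(h,a)] the central coordinate rotates with angular velocity
    [4 pi a + 2 pi beta h g], where [beta h g] is the derivative of the Bott cocycle,
    obtained by differentiating under the integral sign ([is_derive_bott]).  The
    antisymmetrized second derivative ([beta_derivative_swap]) is [beta] of the bracket
    plus a multiple of [omega].  To conclude from these test functions, every tangent
    vector must be the velocity of some curve ([curve_through]).

    The metric of two right invariant fields is constant, so metric compatibility
    and vanishing torsion give Koszul's formula without derivative terms.  Solving it
    by one integration by parts ([gamma2_koszul]) gives, for [X = (h,a)] and
    [Y = (k,b)], that twice the covariant derivative of [Y] along [X] is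
    [(2h'k + 4hk' + bh''' + ak''', - omega(h,k))], again right invariant.  Since the
    connection is skew for the inner product, the curvature expression becomes
    [<2 nabla_X X, 2 nabla_Y Y> - <2 nabla_Y X, 2 nabla_X Y>] and one Koszul term
    ([curvature_gamma2]).  Its integrand agrees pointwise with the claimed one in
    degrees 0 and 2 in [a, b], and up to an explicit total derivative in degree 1; the
    nonlocal terms add up to [3 omega(h,k)^2]. *)

(** * Extensionality *)

Lemma vect_ext (h k : vect) : (forall x, h x = k x) -> h = k.
Proof.
destruct h as [h h1 h2], k as [k k1 k2]; simpl; intros E.
assert (h = k) by now apply functional_extensionality.
subst k; f_equal; apply proof_irrelevance.
Qed.

Lemma vir_ext (X Y : vir) :
  (forall x, fst X x = fst Y x) -> snd X = snd Y -> X = Y.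
Proof.
destruct X, Y; simpl; intros E ->; f_equal; now apply vect_ext.
Qed.

Lemma VB_ext (g g' : VB) :
  (forall x, lift g x = lift g' x) -> central g = central g' -> g = g'.
Proof.
destruct g as [f z p1 p2 p3 p4], g' as [f' z' q1 q2 q3 q4]; simpl; intros E E'.
assert (f = f') by now apply functional_extensionality.
subst f' z'; f_equal; apply proof_irrelevance.
Qed.

Lemma vfield_ext (X Y : vfield) : (forall g, X g = Y g) -> X = Y.
Proof.
destruct X as [X p q], Y as [Y p' q']; simpl; intros E.
assert (X = Y) by now apply functional_extensionality.
subst Y; f_equal; apply proof_irrelevance.
Qed.

(** * The differential algebra of vector fields on the circle *)

Lemma smooth_Derive f : smooth f -> smooth (Derive f).
Proof.
rewrite !smooth_Ck; intros H n; apply (proj1 (Ck_S n f)), H.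
Qed.

Lemma smooth_mult f g : smooth f -> smooth g -> smooth (fun x => f x * g x).
Proof. rewrite !smooth_Ck; intros Hf Hg n; now apply Ck_mult. Qed.

Lemma Derive_shift f c x : Derive (fun y => f (y + c)) x = Derive f (x + c).
Proof.
exact (Derive_n_comp_trans f 1 x c).
Qed.

Program Definition vect_mul (h k : vect) : vect :=
  @Vect (fun x => h x * k x) _ _.
Next Obligation. apply smooth_mult; apply vfun_smooth. Qed.
Next Obligation. now rewrite !vfun_periodic. Qed.

Program Definition vect_derive (h : vect) : vect := @Vect (Derive h) _ _.
Next Obligation. apply smooth_Derive, vfun_smooth. Qed.
Next Obligation.
rewrite <- Derive_shift; apply Derive_ext, vfun_periodic.
Qed.

Lemma vect_is_derive (h : vect) x : is_derive h x (vect_derive h x).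
Proof. apply Derive_correct, smooth_ex_derive, vfun_smooth. Qed.

Lemma vect_addE h k x : vect_add h k x = h x + k x.
Proof. reflexivity. Qed.

Lemma vect_scalE c h x : vect_scal c h x = c * h x.
Proof. reflexivity. Qed.

Lemma vect_mulE h k x : vect_mul h k x = h x * k x.
Proof. reflexivity. Qed.

Lemma vect_derive_add h k :
  vect_derive (vect_add h k) = vect_add (vect_derive h) (vect_derive k).
Proof.
apply vect_ext; intros x.
apply is_derive_unique, @is_derive_plus; apply vect_is_derive.
Qed.

Lemma vect_derive_scal c h :
  vect_derive (vect_scal c h) = vect_scal c (vect_derive h).
Proof.
apply vect_ext; intros x; apply is_derive_unique, @is_derive_scal, vect_is_derive.
Qed.

Lemma vect_derive_mul h k :
  vect_derive (vect_mul h k) =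
  vect_add (vect_mul (vect_derive h) k) (vect_mul h (vect_derive k)).
Proof.
apply vect_ext; intros x.
apply is_derive_unique, (is_derive_mult h k x); try apply vect_is_derive.
intros; apply Rmult_comm.
Qed.

Ltac vect_simpl :=
  repeat first [rewrite vect_derive_add | rewrite vect_derive_scal
    | rewrite vect_derive_mul | rewrite vect_addE | rewrite vect_scalE
    | rewrite vect_mulE].

Lemma vect_continuous (h : vect) x : continuous h x.
Proof. apply @ex_derive_continuous, smooth_ex_derive, vfun_smooth. Qed.

Lemma vect_ex_RInt (h : vect) a b : ex_RInt h a b.
Proof. apply @ex_RInt_continuous; intros; apply vect_continuous. Qed.

(** * Integration over the circle *)

Lemma two_PI_pos : 0 < 2 * PI.
Proof. pose proof PI_RGT_0; lra. Qed.

Lemma int_S1_ext f g : (forall x, f x = g x) -> int_S1 f = int_S1 g.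
Proof. intros E; apply RInt_ext; auto. Qed.

Lemma int_S1_add (h k : vect) : int_S1 (vect_add h k) = int_S1 h + int_S1 k.
Proof. apply @RInt_plus; apply vect_ex_RInt. Qed.

Lemma int_S1_scal c (h : vect) : int_S1 (vect_scal c h) = c * int_S1 h.
Proof. apply @RInt_scal, vect_ex_RInt. Qed.

Lemma int_S1_derive (h : vect) : int_S1 (vect_derive h) = 0.
Proof.
unfold int_S1; change (vfun (vect_derive h)) with (Derive h).
rewrite RInt_Derive.
- rewrite <- (Rplus_0_l (2 * PI)) at 1; rewrite vfun_periodic; ring.
- intros; apply smooth_ex_derive, vfun_smooth.
- intros; apply (vect_continuous (vect_derive h)).
Qed.

(** Integration by parts, with the boundary term [Q] given in advance. *)
Lemma int_S1_exact (A B Q : vect) :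
  (forall x, A x = B x + vect_derive Q x) -> int_S1 A = int_S1 B.
Proof.
intros E; rewrite (int_S1_ext A (vect_add B (vect_derive Q))) by exact E.
rewrite int_S1_add, int_S1_derive; ring.
Qed.

(** The antiderivative of a periodic function changes by the same amount over
    every period. *)
Lemma RInt_period (h : vect) x : RInt h x (x + 2 * PI) = int_S1 h.
Proof.
set (P := fun y => RInt h 0 y).
assert (HP : forall y, is_derive P y (h y)).
{ intros y; apply (is_derive_RInt h P 0 y).
  - apply filter_forall; intros z; apply @RInt_correct, vect_ex_RInt.
  - apply vect_continuous. }
assert (HD : forall y, is_derive (fun z => P (z + 2 * PI) - P z) y 0).
{ intros y; evar_last.
  - apply @is_derive_minus; [|apply HP].
    apply (is_derive_comp P (fun z => z + 2 * PI)); [apply HP|].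
    apply @is_derive_plus; [apply is_derive_id|apply @is_derive_const].
  - rewrite vfun_periodic; unfold minus, plus, opp, scal, mult, one, zero; simpl.
    unfold mult; simpl; ring. }
assert (HC : forall y, P (y + 2 * PI) - P y = P (0 + 2 * PI) - P 0).
{ intros y; destruct (Rtotal_order y 0) as [H|[->|H]].
  - apply (eq_is_derive (fun z => P (z + 2 * PI) - P z)); auto.
  - reflexivity.
  - symmetry; apply (eq_is_derive (fun z => P (z + 2 * PI) - P z)); auto. }
specialize (HC x); unfold P in HC; rewrite RInt_point, Rplus_0_l in HC.
unfold int_S1.
rewrite <- (RInt_Chasles h x 0) by apply vect_ex_RInt.
rewrite <- (opp_RInt_swap h) by apply vect_ex_RInt.
unfold plus, opp, zero in *; simpl in *; lra.
Qed.

(** The antiderivative of [h] based at [x - PI] is nondecreasing and vanishes at both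
    ends of a period around [x], so it is locally constant at [x]. *)
Lemma int_S1_eq0 (h : vect) :
  (forall x, 0 <= h x) -> int_S1 h = 0 -> forall x, h x = 0.
Proof.
intros Hpos H0 x.
set (a := x - PI); pose proof two_PI_pos as HPI.
set (P := fun y => RInt h a y).
assert (HP : is_derive P x (h x)).
{ apply (is_derive_RInt h P a x).
  - apply filter_forall; intros z; apply @RInt_correct, vect_ex_RInt.
  - apply vect_continuous. }
assert (Hge : forall u v, u <= v -> 0 <= RInt h u v).
{ intros u v Huv; apply RInt_ge_0; auto using vect_ex_RInt. }
assert (HP0 : forall y, a <= y <= a + 2 * PI -> P y = 0).
{ intros y Hy; pose proof (RInt_period h a) as E; rewrite H0 in E.
  rewrite <- (RInt_Chasles h a y) in E by apply vect_ex_RInt.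
  pose proof (Hge a y (proj1 Hy)); pose proof (Hge y _ (proj2 Hy)).
  unfold P, plus in *; simpl in *; lra. }
rewrite <- (is_derive_unique _ _ _ HP).
apply is_derive_unique, (is_derive_ext_loc (fun _ => 0)).
- exists (mkposreal PI PI_RGT_0); intros y Hy; symmetry; apply HP0.
  apply Rabs_def2 in Hy; unfold minus, plus, opp in Hy; simpl in Hy.
  unfold a; lra.
- apply @is_derive_const.
Qed.

Lemma periodic_Z (f : R -> R) : (forall x, f (x + 2 * PI) = f x) ->
  forall (n : Z) x, f (x + IZR n * (2 * PI)) = f x.
Proof.
intros H; assert (HN : forall n x, f (x + INR n * (2 * PI)) = f x).
{ induction n as [|n IH]; intros x.
  - simpl; f_equal; ring.
  - rewrite <- (IH x), <- (H (x + INR n * (2 * PI))), S_INR; f_equal; ring. }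
intros n x; destruct (Z_le_gt_dec 0 n) as [Hn|Hn].
- rewrite <- (Z2Nat.id n Hn), <- INR_IZR_INZ; apply HN.
- rewrite <- (HN (Z.to_nat (- n)) (x + _)); f_equal.
  rewrite INR_IZR_INZ, Z2Nat.id, opp_IZR by lia; ring.
Qed.

Lemma reduce_to_period x : exists n : Z, 0 <= x + IZR n * (2 * PI) <= 2 * PI.
Proof.
pose proof two_PI_pos as HPI.
exists (- Int_part (x / (2 * PI)))%Z; rewrite opp_IZR.
destruct (base_Int_part (x / (2 * PI))) as [H1 H2].
set (m := IZR (Int_part _)) in *.
assert (E : x = x / (2 * PI) * (2 * PI)) by (field; pose proof PI_RGT_0; lra).
set (y := x / (2 * PI)) in *; rewrite E; split; nra.
Qed.

Lemma vect_bounded (h : vect) : exists M, 0 < M /\ forall x, Rabs (h x) < M.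
Proof.
destruct (bounded_continuity h 0 (2 * PI)) as [M HM].
- intros x _; apply vect_continuous.
- exists M.
  assert (H : forall x, Rabs (h x) < M).
  { intros x; destruct (reduce_to_period x) as [n Hn].
    rewrite <- (periodic_Z h (vfun_periodic h) n x); exact (HM _ Hn). }
  split; [|exact H].
  apply Rle_lt_trans with (Rabs (h 0)); [apply Rabs_pos|apply H].
Qed.

(** * Curves with a prescribed velocity *)

Lemma smooth2_plus F G :
  smooth2 F -> smooth2 G -> smooth2 (fun t x => F t x + G t x).
Proof.
intros [D [D0 HD]] [E [E0 HE]]; exists (fun i j t x => D i j t x + E i j t x).
split; [intros; now rewrite D0, E0|].
intros i j t x; destruct (HD i j t x) as (d1 & d2 & d3), (HE i j t x) as (e1 & e2 & e3).
split; [|split].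
- exact (is_derive_plus _ _ _ _ _ d1 e1).
- exact (is_derive_plus _ _ _ _ _ d2 e2).
- now apply continuity_2d_pt_plus.
Qed.

Lemma smooth_is_derive_n f n x :
  smooth f -> is_derive (Derive_n f n) x (Derive_n f (S n) x).
Proof. intros H; exact (Derive_correct _ _ (H (S n) x)). Qed.

Lemma is_derive_continuity_pt (f : R -> R) x l : is_derive f x l -> continuity_pt f x.
Proof.
intros H; apply derivable_continuous_pt, ex_derive_Reals_0; now exists l.
Qed.

Lemma smooth2_prod f h :
  smooth f -> smooth h -> smooth2 (fun t x => f t * h x).
Proof.
intros Hf Hh; exists (fun i j t x => Derive_n f i t * Derive_n h j x).
split; [reflexivity|]; intros i j t x; split; [|split].
- evar_last.
  + apply @is_derive_mult; [now apply smooth_is_derive_n|apply @is_derive_const|].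
    intros; apply Rmult_comm.
  + unfold plus, mult, zero; simpl; ring.
- evar_last.
  + apply @is_derive_mult; [apply @is_derive_const|now apply smooth_is_derive_n|].
    intros; apply Rmult_comm.
  + unfold plus, mult, zero; simpl; ring.
- apply continuity_2d_pt_mult.
  + apply (continuity_1d_2d_pt_comp (Derive_n f i) (fun u _ => u)).
    * eapply is_derive_continuity_pt; now apply smooth_is_derive_n.
    * apply continuity_2d_pt_id1.
  + apply (continuity_1d_2d_pt_comp (Derive_n h j) (fun _ u => u)).
    * eapply is_derive_continuity_pt; now apply smooth_is_derive_n.
    * apply continuity_2d_pt_id2.
Qed.

Lemma smooth2_section F x : smooth2 F -> smooth (fun t => F t x).
Proof.
intros [D [D0 HD]].
assert (E : forall n t, Derive_n (fun t => F t x) n t = D n 0%nat t x).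
{ induction n as [|n IH]; intros t; simpl; [symmetry; apply D0|].
  rewrite (Derive_ext _ _ _ IH); apply is_derive_unique, HD. }
intros [|n] t; [exact I|]; simpl.
apply (ex_derive_ext (fun s => D n 0%nat s x)).
- intros s; symmetry; apply E.
- eexists; apply HD.
Qed.

Program Definition perturbation (h : vect) (s r : R)
    (Hs : forall x, 0 < 1 + s * vect_derive h x) : VB :=
  @mkVB (fun x => x + s * h x) (cis r) _ _ _ _.
Next Obligation.
apply smooth_plus; [apply smooth_id|apply smooth_scal, vfun_smooth].
Qed.
Next Obligation. rewrite vfun_periodic; ring. Qed.
Next Obligation.
rewrite Derive_plus, Derive_id, Derive_scal; [apply Hs|apply ex_derive_id|].
apply @ex_derive_scal, smooth_ex_derive, vfun_smooth.
Qed.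
Next Obligation. apply Cmod_cis. Qed.

Lemma smooth_sin_scaled d c : smooth (fun t => d * sin (c * t)).
Proof.
apply smooth_scal, (smooth_comp (f := sin)); [apply (vfun_smooth vect_sin)|].
apply smooth_scal, smooth_id.
Qed.

(** The curve [x + sin (M t) / M * h x] stays in the diffeomorphism group for all
    times when [M] bounds the derivative of [h], and it has velocity [h]; the central
    coordinate runs around the circle with speed [4 pi a]. *)
Lemma curve_through v : exists c, starts_with_velocity c v.
Proof.
destruct v as [h a].
destruct (vect_bounded (vect_derive h)) as [M [M0 HM]].
assert (Hpos : forall t x, 0 < 1 + / M * sin (M * t) * vect_derive h x).
{ intros t x; specialize (HM x); apply Rabs_def2 in HM.
  set (y := vect_derive h x) in *; pose proof (SIN_bound (M * t)) as Hs.
  set (s := sin _) in *.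
  assert (Hi : / M * M = 1) by (field; lra).
  assert (0 < / M) by now apply Rinv_0_lt_compat.
  assert (Hy : -1 < / M * y < 1) by (split; nra).
  replace (/ M * s * y) with (s * (/ M * y)) by ring.
  destruct (Rtotal_order s 0) as [Hs0|[->|Hs0]]; nra. }
exists (fun t => perturbation h (/ M * sin (M * t)) (4 * PI * a * t) (Hpos t)).
split; [split; [|split]|split; [|split; [|split]]]; simpl.
- apply smooth2_plus; [apply smooth2_snd, smooth_id|].
  apply (smooth2_prod (fun t => / M * sin (M * t)) h).
  + apply smooth_sin_scaled.
  + apply vfun_smooth.
- apply (smooth_comp (f := cos)); [apply (vfun_smooth vect_cos)|].
  apply smooth_scal, smooth_id.
- apply (smooth_comp (f := sin)); [apply (vfun_smooth vect_sin)|].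
  apply smooth_scal, smooth_id.
- apply VB_ext; simpl.
  + intros x; rewrite Rmult_0_r, sin_0; ring.
  + unfold cis; now rewrite Rmult_0_r, cos_0, sin_0.
- intros x; auto_derive; [exact I|].
  rewrite Rmult_0_r, cos_0; field; lra.
- auto_derive; [exact I|]; rewrite Rmult_0_r, sin_0; ring.
- auto_derive; [exact I|]; rewrite Rmult_0_r, cos_0; ring.
Qed.

(** Two values can only be compared along an actual curve, hence the appeal to
    [curve_through]. *)
Lemma is_dir_derive_unique f g v l1 l2 :
  is_dir_derive f g v l1 -> is_dir_derive f g v l2 -> l1 = l2.
Proof.
intros H1 H2; destruct (curve_through v) as [c Hc].
rewrite <- (is_derive_unique _ _ _ (H1 c Hc)).
exact (is_derive_unique _ _ _ (H2 c Hc)).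
Qed.

Lemma is_dir_derive_const r g v : is_dir_derive (fun _ => r) g v 0.
Proof. intros c _; apply @is_derive_const. Qed.

(** * First derivatives of functions on the group *)

Lemma bott_one g : bott (fun x => x) (lift g) = 0.
Proof.
unfold bott; rewrite (int_S1_ext _ (fun _ => 0)).
- unfold int_S1; rewrite RInt_const; apply Rmult_0_r.
- intros x; rewrite Derive_id, ln_1; ring.
Qed.

Lemma vb_mul_one g : vb_mul vb_one g = g.
Proof.
apply VB_ext; [reflexivity|]; simpl.
rewrite bott_one; unfold cis; rewrite Rmult_0_r, cos_0, sin_0.
change (1, 0) with (RtoC 1); ring.
Qed.

Lemma starts_translate c v g : starts_with_velocity c v -> vb_mul (c 0) g = g.
Proof. intros (_ & -> & _); apply vb_mul_one. Qed.

Lemma is_dir_derive_mult f1 f2 g v l1 l2 :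
  is_dir_derive f1 g v l1 -> is_dir_derive f2 g v l2 ->
  is_dir_derive (fun g => f1 g * f2 g) g v (l1 * f2 g + f1 g * l2).
Proof.
intros H1 H2 c Hc; evar_last.
- apply @is_derive_mult; [exact (H1 c Hc)|exact (H2 c Hc)|].
  intros; apply Rmult_comm.
- cbv beta; rewrite (starts_translate _ _ _ Hc); reflexivity.
Qed.

Lemma is_dir_derive_eval (p : vect) x g v :
  is_dir_derive (fun g => p (lift g x)) g v
    (vect_mul (fst v) (vect_derive p) (lift g x)).
Proof.
intros c Hc; simpl.
apply (is_derive_comp p (fun t => lift (c t) (lift g x))).
- destruct Hc as (_ & -> & _); apply vect_is_derive.
- apply Hc.
Qed.

Lemma smooth_fun_eval (p : vect) x : smooth_fun (fun g => p (lift g x)).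
Proof.
split.
- intros g g' [_ [n Hn]]; rewrite Hn; symmetry; apply periodic_Z, vfun_periodic.
- intros c [Hc _]; apply (smooth_comp (f := p)); [apply vfun_smooth|].
  now apply (smooth2_section (fun t x => lift (c t) x)).
Qed.

(** The test functions only see the values of a vector field at points
    [lift g x]. *)
Lemma lift_surjective g y : exists x, lift g x = y.
Proof.
destruct (reduce_to_period (y - lift g 0)) as [n Hn].
destruct (IVT_gen (lift g) 0 (2 * PI) (y + IZR n * (2 * PI))) as [x [_ Hx]].
- intros x; apply derivable_continuous_pt, ex_derive_Reals_0.
  apply smooth_ex_derive, lift_smooth.
- assert (E : lift g (2 * PI) = lift g 0 + 2 * PI).
  { rewrite <- lift_shift; f_equal; ring. }
  pose proof two_PI_pos; rewrite E, Rmin_left, Rmax_right; lra.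
- exists (x + IZR (- n) * (2 * PI)).
  pose proof (periodic_Z (fun x => lift g x - x)) as P; simpl in P.
  assert (E : lift g (x + IZR (- n) * (2 * PI)) - (x + IZR (- n) * (2 * PI))
    = lift g x - x) by (apply P; intros; rewrite lift_shift; ring).
  rewrite opp_IZR in *; lra.
Qed.

(** * Differentiating the Bott cocycle along right translates *)

Lemma continuity_2d_pt_comp_snd F f t y :
  continuity_2d_pt F t (f y) -> continuity_pt f y ->
  continuity_2d_pt (fun s z => F s (f z)) t y.
Proof.
intros HF Hf eps; destruct (HF eps) as [d Hd].
destruct (proj1 (continuity_pt_locally f y) Hf d) as [d' Hd'].
assert (Hm : 0 < Rmin d d') by (apply Rmin_pos; apply cond_pos).
exists (mkposreal _ Hm); simpl; intros u v Hu Hv; apply Hd.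
- eapply Rlt_le_trans; [exact Hu|apply Rmin_l].
- apply Hd'; eapply Rlt_le_trans; [exact Hv|apply Rmin_r].
Qed.

Lemma continuity_2d_pt_snd f t y :
  continuity_pt f y -> continuity_2d_pt (fun _ z => f z) t y.
Proof.
intros Hf; apply (continuity_1d_2d_pt_comp f (fun _ z => z)); [exact Hf|].
apply continuity_2d_pt_id2.
Qed.

(** Differentiation under the integral sign. *)
Lemma is_derive_int_S1 (G G' : R -> R -> R) t0 :
  (forall t y, is_derive (fun s => G s y) t (G' t y)) ->
  (forall t y, continuity_2d_pt G t y) ->
  (forall t y, continuity_2d_pt G' t y) ->
  is_derive (fun t => int_S1 (G t)) t0 (int_S1 (G' t0)).
Proof.
intros HD HG HG'.
rewrite (int_S1_ext (G' t0) (fun y => Derive (fun s => G s y) t0)).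
- apply is_derive_RInt_param.
  + apply filter_forall; intros t y _; eexists; apply HD.
  + intros y _; apply continuity_2d_pt_ext with G'; [|apply HG'].
    intros s z; symmetry; apply is_derive_unique, HD.
  + apply filter_forall; intros t; apply @ex_RInt_continuous; intros y _.
    apply continuity_pt_filterlim, continuity_pt_locally; intros eps.
    destruct (HG t y eps) as [d Hd]; exists d; intros z Hz.
    apply Hd; [|exact Hz]; rewrite Rminus_diag, Rabs_R0; apply cond_pos.
- intros y; symmetry; apply is_derive_unique, HD.
Qed.

(** [D i j] is the partial derivative of the lift of [c], [i] times in the time and
    [j] times in the space variable; the equations at time 0 come from [c 0] being
    the identity and [h] the velocity. *)
Record velocity_jet (c : R -> VB) (h : vect) (D : nat -> nat -> R -> R -> R) : Prop := {
  jet_lift : forall t x, lift (c t) x = D 0%nat 0%nat t x;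
  jet_t : forall i j t x, is_derive (fun s => D i j s x) t (D (S i) j t x);
  jet_x : forall i j t x, is_derive (fun y => D i j t y) x (D i (S j) t x);
  jet_cont : forall i j t x, continuity_2d_pt (D i j) t x;
  jet_pos : forall t x, 0 < D 0%nat 1%nat t x;
  jet_00 : forall x, D 0%nat 0%nat 0 x = x;
  jet_01 : forall x, D 0%nat 1%nat 0 x = 1;
  jet_02 : forall x, D 0%nat 2%nat 0 x = 0;
  jet_10 : forall x, D 1%nat 0%nat 0 x = h x;
  jet_11 : forall x, D 1%nat 1%nat 0 x = vect_derive h x;
  jet_12 : forall x, D 1%nat 2%nat 0 x = vect_derive (vect_derive h) x }.

Lemma velocity_jet_exists c v :
  starts_with_velocity c v -> exists D, velocity_jet c (fst v) D.
Proof.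
intros ([[D [D0 HD]] _] & c0 & Hv & _); exists D.
assert (H00 : forall x, D 0%nat 0%nat 0 x = x) by (intros x; now rewrite D0, c0).
assert (H01 : forall x, D 0%nat 1%nat 0 x = 1).
{ intros x; destruct (HD 0%nat 0%nat 0 x) as (_ & H & _).
  rewrite <- (is_derive_unique _ _ _ H), (Derive_ext _ _ _ H00); apply Derive_id. }
assert (H02 : forall x, D 0%nat 2%nat 0 x = 0).
{ intros x; destruct (HD 0%nat 1%nat 0 x) as (_ & H & _).
  rewrite <- (is_derive_unique _ _ _ H), (Derive_ext _ _ _ H01); apply Derive_const. }
assert (H10 : forall x, D 1%nat 0%nat 0 x = fst v x).
{ intros x; destruct (HD 0%nat 0%nat 0 x) as (H & _ & _).
  rewrite <- (is_derive_unique _ _ _ H), <- (is_derive_unique _ _ _ (Hv x)).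
  apply Derive_ext; intros; apply D0. }
assert (H11 : forall x, D 1%nat 1%nat 0 x = vect_derive (fst v) x).
{ intros x; destruct (HD 1%nat 0%nat 0 x) as (_ & H & _).
  rewrite <- (is_derive_unique _ _ _ H), (Derive_ext _ _ _ H10); reflexivity. }
split; auto; try (intros; apply HD).
- intros t x; destruct (HD 0%nat 0%nat t x) as (_ & H & _).
  rewrite <- (is_derive_unique _ _ _ H), (Derive_ext _ _ _ (D0 t)).
  apply lift_orient.
- intros x; destruct (HD 1%nat 1%nat 0 x) as (_ & H & _).
  rewrite <- (is_derive_unique _ _ _ H), (Derive_ext _ _ _ H11); reflexivity.
Qed.

(** The derivative of [phi |-> bott phi (lift g)] at the identity in the direction
    [h]; see [is_derive_bott]. *)
Definition beta (h : vect) (g : VB) : R :=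
  int_S1 (fun y => vect_derive h (lift g y) * Derive (fun z => ln (Derive (lift g) z)) y).

Lemma is_derive_Derive (f : R -> R) (x l : R) :
  is_derive f x l -> Derive (fun z : R => f z) x = l.
Proof. apply is_derive_unique. Qed.

Lemma Derive_ln_Derive f f1 f2 y :
  (forall x, 0 < f1 x) -> (forall x, is_derive f x (f1 x)) ->
  is_derive f1 y f2 -> Derive (fun z => ln (Derive f z)) y = f2 / f1 y.
Proof.
intros Hpos H1 H2; apply is_derive_unique.
apply (is_derive_ext (fun z => ln (f1 z))).
- intros z; f_equal; symmetry; now apply is_derive_unique.
- auto_derive; [now split; [eexists; eauto|]|].
  rewrite (is_derive_Derive _ _ _ H2).
  field; apply Rgt_not_eq, Hpos.
Qed.

Definition dlift (g : VB) (n : nat) : R -> R := Derive_n (lift g) n.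

Lemma is_derive_dlift g n x : is_derive (dlift g n) x (dlift g (S n) x).
Proof. apply smooth_is_derive_n, lift_smooth. Qed.

Lemma continuity_dlift g n x : continuity_pt (dlift g n) x.
Proof. eapply is_derive_continuity_pt, is_derive_dlift. Qed.

Lemma dlift_neq0 g x : dlift g 1 x <> 0.
Proof. apply Rgt_not_eq, lift_orient. Qed.

Lemma betaE h g : beta h g =
  int_S1 (fun y => vect_derive h (lift g y) * (dlift g 2 y / dlift g 1 y)).
Proof.
apply int_S1_ext; intros y.
rewrite (Derive_ln_Derive _ (dlift g 1) (dlift g 2 y)); [reflexivity|..].
- apply lift_orient.
- apply (is_derive_dlift g 0).
- apply (is_derive_dlift g 1).
Qed.

Lemma vect_continuity_pt (h : vect) x : continuity_pt h x.
Proof. eapply is_derive_continuity_pt, vect_is_derive. Qed.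

Ltac continuity_2d :=
  unfold Rdiv;
  repeat first
    [ apply continuity_2d_pt_plus | apply continuity_2d_pt_opp
    | apply continuity_2d_pt_mult | apply continuity_2d_pt_inv
    | apply continuity_2d_pt_const
    | apply continuity_2d_pt_snd; apply continuity_dlift ].

Lemma is_derive_bott c v g :
  starts_with_velocity c v ->
  is_derive (fun t => bott (lift (c t)) (lift g)) 0 (beta (fst v) g).
Proof.
intros Hc; destruct (velocity_jet_exists _ _ Hc) as [D HD].
set (w := fun y => dlift g 2 y / dlift g 1 y).
set (G := fun t y => ln (D 0%nat 1%nat t (lift g y)) * w y).
set (G' := fun t y => D 1%nat 1%nat t (lift g y) / D 0%nat 1%nat t (lift g y) * w y).
apply (is_derive_ext (fun t => int_S1 (G t))).
{ intros t; apply int_S1_ext; intros y; unfold G, w; f_equal.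
  - f_equal; symmetry; apply is_derive_unique.
    apply (is_derive_ext (D 0%nat 0%nat t)); [|apply (jet_x _ _ _ HD)].
    intros; symmetry; apply (jet_lift _ _ _ HD).
  - symmetry; apply Derive_ln_Derive.
    + apply lift_orient.
    + apply (is_derive_dlift g 0).
    + apply (is_derive_dlift g 1). }
assert (E : beta (fst v) g = int_S1 (G' 0)).
{ rewrite betaE; apply int_S1_ext; intros y; unfold G', w.
  rewrite (jet_11 _ _ _ HD), (jet_01 _ _ _ HD); field; apply dlift_neq0. }
assert (HDc : forall i j t y,
  continuity_2d_pt (fun s z => D i j s (lift g z)) t y).
{ intros; apply continuity_2d_pt_comp_snd; [apply (jet_cont _ _ _ HD)|].
  apply (continuity_dlift g 0). }
assert (HD0 : forall t x, D 0%nat 1%nat t x <> 0).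
{ intros; apply Rgt_not_eq, (jet_pos _ _ _ HD). }
rewrite E; apply is_derive_int_S1; intros t y; unfold G, G', w.
- evar_last.
  + auto_derive; [|reflexivity]; split; [|split; [|exact I]].
    * eexists; apply (jet_t _ _ _ HD).
    * apply (jet_pos _ _ _ HD).
  + rewrite (is_derive_Derive _ _ _ (jet_t _ _ _ HD 0%nat 1%nat t (lift g y))).
    field; split; [apply dlift_neq0|apply HD0].
- continuity_2d; [|apply dlift_neq0].
  apply (continuity_1d_2d_pt_comp ln); [|apply HDc].
  eapply is_derive_continuity_pt, is_derive_ln, (jet_pos _ _ _ HD).
- continuity_2d; auto using dlift_neq0.
Qed.

(** The derivative of [beta h] at [g] along the right translate of [k]: the first
    summand comes from moving the argument of [h'], the second from the change of
    [log] of the derivative of the lift. *)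
Definition beta_derivative (h k : vect) (g : VB) : R :=
  int_S1 (fun y =>
    vect_derive (vect_derive h) (lift g y) * k (lift g y) * (dlift g 2 y / dlift g 1 y)
    + vect_derive h (lift g y) * vect_derive (vect_derive k) (lift g y) * dlift g 1 y).

(** With [psi] the lift of [c t] after [g], the logarithmic derivative of [psi'] is
    [(D02 / D01) g' + g'' / g'] at [lift g y], where [Dij = D i j t]. *)
Lemma is_dir_derive_beta h g v :
  is_dir_derive (beta h) g v (beta_derivative h (fst v) g).
Proof.
intros c Hc; destruct (velocity_jet_exists _ _ Hc) as [D HD].
set (G := fun t y => vect_derive h (D 0%nat 0%nat t (lift g y)) *
  (D 0%nat 2%nat t (lift g y) / D 0%nat 1%nat t (lift g y) * dlift g 1 y
   + dlift g 2 y / dlift g 1 y)).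
set (G' := fun t y =>
  vect_derive (vect_derive h) (D 0%nat 0%nat t (lift g y)) * D 1%nat 0%nat t (lift g y) *
  (D 0%nat 2%nat t (lift g y) / D 0%nat 1%nat t (lift g y) * dlift g 1 y
   + dlift g 2 y / dlift g 1 y)
  + vect_derive h (D 0%nat 0%nat t (lift g y)) *
   ((D 1%nat 2%nat t (lift g y) * D 0%nat 1%nat t (lift g y)
     - D 0%nat 2%nat t (lift g y) * D 1%nat 1%nat t (lift g y))
    / (D 0%nat 1%nat t (lift g y) * D 0%nat 1%nat t (lift g y)) * dlift g 1 y)).
assert (HD0 : forall t x, D 0%nat 1%nat t x <> 0).
{ intros; apply Rgt_not_eq, (jet_pos _ _ _ HD). }
assert (Hx : forall j t y, is_derive (fun z => D 0%nat j t (lift g z)) y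
    (dlift g 1 y * D 0%nat (S j) t (lift g y))).
{ intros; apply (is_derive_comp (D 0%nat j t) (lift g)).
  - apply (jet_x _ _ _ HD).
  - apply (is_derive_dlift g 0). }
apply (is_derive_ext (fun t => int_S1 (G t))).
{ intros t; apply int_S1_ext; intros y; unfold G; simpl.
  rewrite (jet_lift _ _ _ HD); f_equal.
  rewrite (Derive_ln_Derive _
    (fun z => dlift g 1 z * D 0%nat 1%nat t (lift g z))
    (dlift g 2 y * D 0%nat 1%nat t (lift g y)
     + dlift g 1 y * (dlift g 1 y * D 0%nat 2%nat t (lift g y)))).
  - field; split; (apply dlift_neq0 || apply HD0).
  - intros z; apply Rmult_lt_0_compat; [apply lift_orient|apply (jet_pos _ _ _ HD)].
  - intros z; apply (is_derive_ext (fun z => D 0%nat 0%nat t (lift g z))).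
    + intros; symmetry; apply (jet_lift _ _ _ HD).
    + apply Hx.
  - apply (is_derive_mult (dlift g 1) (fun z => D 0%nat 1%nat t (lift g z)));
      [apply is_derive_dlift|apply Hx|intros; apply Rmult_comm]. }
assert (E : beta_derivative h (fst v) g = int_S1 (G' 0)).
{ apply int_S1_ext; intros y; unfold G'.
  rewrite (jet_00 _ _ _ HD), (jet_01 _ _ _ HD), (jet_02 _ _ _ HD),
    (jet_10 _ _ _ HD), (jet_11 _ _ _ HD), (jet_12 _ _ _ HD).
  field; apply dlift_neq0. }
assert (HDc : forall i j t y,
  continuity_2d_pt (fun s z => D i j s (lift g z)) t y).
{ intros; apply continuity_2d_pt_comp_snd; [apply (jet_cont _ _ _ HD)|].
  apply (continuity_dlift g 0). }
assert (HV : forall (k : vect) t y,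
  continuity_2d_pt (fun s z => k (D 0%nat 0%nat s (lift g z))) t y).
{ intros; apply (continuity_1d_2d_pt_comp k); [apply vect_continuity_pt|apply HDc]. }
rewrite E; apply is_derive_int_S1; intros t y; unfold G, G'.
- set (x := lift g y).
  assert (Hh : is_derive (fun s => vect_derive h (D 0%nat 0%nat s x)) t
    (D 1%nat 0%nat t x * vect_derive (vect_derive h) (D 0%nat 0%nat t x))).
  { apply (is_derive_comp (vect_derive h) (fun s => D 0%nat 0%nat s x)).
    - apply vect_is_derive.
    - apply (jet_t _ _ _ HD). }
  evar_last.
  + apply @is_derive_mult; [exact Hh| |intros; apply Rmult_comm].
    auto_derive; [|reflexivity].
    repeat split; try (eexists; apply (jet_t _ _ _ HD)); apply HD0.
  + rewrite !(is_derive_Derive _ _ _ (jet_t _ _ _ HD _ _ t x)).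
    unfold plus, mult; simpl; field; split; (apply dlift_neq0 || apply HD0).
- continuity_2d; auto using dlift_neq0.
- continuity_2d; auto using dlift_neq0, Rmult_integral_contrapositive_currified.
Qed.

(** * The Lie bracket of right invariant vector fields *)

(** The real linear forms in the central coordinate.  Turning the circle by a right
    angle sends the form with coefficients [u, v] to the one with [v, - u]. *)
Definition central_form (u v : R) (g : VB) : R :=
  u * fst (central g) + v * snd (central g).

Lemma smooth_fun_central_form u v : smooth_fun (central_form u v).
Proof.
split.
- intros g g' [E _]; unfold central_form; now rewrite E.
- intros c (_ & H1 & H2); apply smooth_plus; now apply smooth_scal.
Qed.

(** The angular velocity of the central coordinate along the right translate
    of [X] to [g]. *)
Definition angular (X : vir) (g : VB) : R :=
  4 * PI * snd X + 2 * PI * beta (fst X) g.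

(** The real form of the product rule for [z(t) z0 e^(2 pi i b(t))], where
    [z = p + i q] starts at 1 with velocity [i A] and [z0 = r + i s]. *)
Lemma is_derive_rotation (p q b : R -> R) (u v r s A B : R) :
  p 0 = 1 -> q 0 = 0 -> b 0 = 0 ->
  is_derive p 0 0 -> is_derive q 0 A -> is_derive b 0 B ->
  is_derive (fun t =>
    u * ((p t * r - q t * s) * cos (2 * PI * b t)
         - (p t * s + q t * r) * sin (2 * PI * b t))
    + v * ((p t * r - q t * s) * sin (2 * PI * b t)
         + (p t * s + q t * r) * cos (2 * PI * b t))) 0
    ((A + 2 * PI * B) * (v * r + - u * s)).
Proof.
intros p0 q0 b0 Hp Hq Hb; auto_derive.
- repeat split; eexists; eassumption.
- rewrite (is_derive_Derive _ _ _ Hp), (is_derive_Derive _ _ _ Hq),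
    (is_derive_Derive _ _ _ Hb), p0, q0, b0, !Rmult_0_r, cos_0, sin_0; ring.
Qed.

Lemma is_dir_derive_central_form u v g X :
  is_dir_derive (central_form u v) g X (angular X g * central_form v (- u) g).
Proof.
intros c Hc; pose proof (is_derive_bott _ _ g Hc) as Hb.
destruct Hc as (_ & c0 & _ & H1 & H2).
unfold central_form, angular; simpl.
apply (is_derive_rotation (fun t => fst (central (c t)))
  (fun t => snd (central (c t))) (fun t => bott (lift (c t)) (lift g))); auto;
  rewrite c0; try reflexivity; apply bott_one.
Qed.

(** Substitution leads to an integral over the period that starts at [lift g 0]. *)
Lemma int_S1_change_of_variable (h : vect) g :
  int_S1 (fun y => h (lift g y) * dlift g 1 y) = int_S1 h.
Proof.
rewrite <- (RInt_period h (lift g 0)), <- lift_shift, Rplus_0_l.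
symmetry; unfold int_S1.
rewrite <- (RInt_comp h (lift g) (dlift g 1)).
- apply RInt_ext; intros; apply Rmult_comm.
- intros; apply vect_continuous.
- intros; split; [apply (is_derive_dlift g 0)|].
  apply continuity_pt_filterlim, continuity_dlift.
Qed.

Definition vect_bracket (h k : vect) : vect :=
  vect_add (vect_mul (vect_derive h) k) (vect_scal (-1) (vect_mul h (vect_derive k))).

Definition vir_bracket (X Y : vir) : vir :=
  (vect_bracket (fst X) (fst Y), omega (fst X) (fst Y)).

Lemma omega_skew (h k : vect) : omega h k = - omega k h.
Proof.
change (int_S1 (vect_mul (vect_derive h) (vect_derive (vect_derive k)))
  = - int_S1 (vect_mul (vect_derive k) (vect_derive (vect_derive h)))).
rewrite (int_S1_exact _
  (vect_scal (-1) (vect_mul (vect_derive k) (vect_derive (vect_derive h))))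
  (vect_mul (vect_derive h) (vect_derive k))).
- rewrite int_S1_scal; ring.
- intros x; vect_simpl; ring.
Qed.

Lemma int_S1_plus (f1 f2 : R -> R) :
  (forall x, ex_derive f1 x) -> (forall x, ex_derive f2 x) ->
  int_S1 (fun x => f1 x + f2 x) = int_S1 f1 + int_S1 f2.
Proof.
intros H1 H2; apply @RInt_plus; apply @ex_RInt_continuous;
  intros; now apply @ex_derive_continuous.
Qed.

Lemma ex_derive_dlift g n x : ex_derive (dlift g n) x.
Proof. eexists; apply is_derive_dlift. Qed.

Lemma ex_derive_vect_lift (h : vect) g x : ex_derive (fun y => h (lift g y)) x.
Proof.
apply (@ex_derive_comp _ _ h (lift g)).
- eexists; apply vect_is_derive.
- apply (ex_derive_dlift g 0).
Qed.

Ltac ex_derive_along :=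
  intros;
  lazymatch goal with
  | |- ex_derive (fun x => _ + _) _ => apply @ex_derive_plus; ex_derive_along
  | |- ex_derive (fun x => _ * _) _ => apply ex_derive_mult; ex_derive_along
  | |- ex_derive (fun x => _ / _) _ => apply ex_derive_div; ex_derive_along
  | |- ex_derive (fun x => vfun ?h (lift ?g x)) _ => apply (ex_derive_vect_lift h g)
  | |- ex_derive (dlift ?g ?n) _ => apply (ex_derive_dlift g n)
  | |- _ <> 0 => apply dlift_neq0
  end.

(** Against [g'' / g'] the antisymmetrized integrand is the derivative of the bracket
    of [k] and [h].  The remaining part is [(k'h'' - h'k'')] composed with the lift times
    its derivative, which integrates to [- 2 omega(h,k)]. *)
Lemma beta_derivative_swap (h k : vect) g :
  beta_derivative k h g =
  beta_derivative h k g + (beta (vect_bracket k h) g - 2 * omega h k).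
Proof.
set (F := vect_add (vect_mul (vect_derive k) (vect_derive (vect_derive h)))
  (vect_scal (-1) (vect_mul (vect_derive h) (vect_derive (vect_derive k))))).
assert (EF : int_S1 F = - 2 * omega h k).
{ unfold F; rewrite int_S1_add, int_S1_scal.
  change (omega k h + -1 * omega h k = -2 * omega h k); rewrite (omega_skew k h).
  ring. }
replace (beta (vect_bracket k h) g - 2 * omega h k)
  with (beta (vect_bracket k h) g + int_S1 F) by (rewrite EF; ring).
rewrite <- (int_S1_change_of_variable F g), betaE; unfold beta_derivative.
rewrite <- int_S1_plus, <- int_S1_plus; [|ex_derive_along..].
apply int_S1_ext; intros y; unfold F, vect_bracket; vect_simpl; field.
apply dlift_neq0.
Qed.

(** The sine shifted by [y], whose derivative at [y] is 1. *)
Definition phase_vect (y : R) : vect :=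
  vect_add (vect_scal (cos y) vect_sin) (vect_scal (- sin y) vect_cos).

Lemma phase_vect_derive y : vect_derive (phase_vect y) y = 1.
Proof.
unfold phase_vect; vect_simpl.
rewrite <- (sin2_cos2 y); unfold Rsqr.
replace (vect_derive vect_sin y) with (cos y)
  by (symmetry; apply is_derive_unique, is_derive_sin).
replace (vect_derive vect_cos y) with (- sin y)
  by (symmetry; apply is_derive_unique, is_derive_cos).
ring.
Qed.

(** The minus sign is the usual one for right invariant fields.  Both components are
    found by computing [XYf - YXf] for a test function [f] whose derivative at [g] in a
    direction is exactly the wanted component: [p (lift g x)] with [p] a shifted sine for
    the vector field part, and a form in the central coordinate for the central part. *)
Lemma bracket_right_inv brk X Y g : is_field_bracket brk ->
  brk (right_inv X) (right_inv Y) g = vscal (-1) (vir_bracket X Y).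
Proof.
intros Hbrk.
assert (E1 : forall y, fst (brk (right_inv X) (right_inv Y) g) y
                       = vect_bracket (fst Y) (fst X) y).
{ intros y; destruct (lift_surjective g y) as [x <-].
  set (p := phase_vect (lift g x)).
  assert (HL : forall Z (q : vect), is_lie_derive (right_inv Z) (fun g => q (lift g x))
    (fun g => vect_mul (fst Z) (vect_derive q) (lift g x))).
  { intros Z q g'; apply is_dir_derive_eval. }
  pose proof (Hbrk (right_inv X) (right_inv Y) _ _ _ _ _ (smooth_fun_eval p x)
    (HL X p) (HL Y p) (HL X _) (HL Y _) g) as H.
  apply (is_dir_derive_unique _ _ _ _ _ (is_dir_derive_eval p x g _)) in H.
  revert H; unfold vect_bracket; vect_simpl.
  unfold p at 1; rewrite phase_vect_derive, Rmult_1_r; intros ->.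
  unfold p; rewrite phase_vect_derive; ring. }
apply vir_ext.
- intros y; rewrite E1; unfold vect_bracket; simpl; ring.
- (* With these coefficients the derivative of [central_form u v] at [g] in a
     direction [Z] is [angular Z g], the central coordinate having modulus 1. *)
  set (u := - snd (central g)); set (v := fst (central g)).
  assert (HL1 : forall Z u v, is_lie_derive (right_inv Z) (central_form u v)
    (fun g => angular Z g * central_form v (- u) g)).
  { intros Z u' v' g'; apply is_dir_derive_central_form. }
  assert (HL2 : forall Z Z' u v, is_lie_derive (right_inv Z)
    (fun g => angular Z' g * central_form u v g)
    (fun g => 2 * PI * beta_derivative (fst Z') (fst Z) g * central_form u v g
              + angular Z' g * (angular Z g * central_form v (- u) g))).
  { intros Z Z' u' v' g'; apply is_dir_derive_mult.
    - intros c Hc; unfold angular; evar_last.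
      + apply @is_derive_plus; [apply @is_derive_const|].
        apply @is_derive_scal, (is_dir_derive_beta _ _ _ _ Hc).
      + unfold plus, zero; simpl; ring.
    - apply is_dir_derive_central_form. }
  pose proof (Hbrk (right_inv X) (right_inv Y) _ _ _ _ _ (smooth_fun_central_form u v)
    (HL1 X u v) (HL1 Y u v) (HL2 X Y _ _) (HL2 Y X _ _) g) as H.
  apply (is_dir_derive_unique _ _ _ _ _ (is_dir_derive_central_form u v g _)) in H.
  assert (E2 : central_form v (- u) g = 1).
  { unfold central_form, u, v; pose proof (central_unit g) as Hu.
    apply (f_equal (fun x => x * x)) in Hu; unfold Cmod in Hu.
    rewrite sqrt_sqrt in Hu by (apply Rplus_le_le_0_compat; apply pow2_ge_0).
    simpl in Hu; lra. }
  cbv beta in H; rewrite E2 in H; unfold angular at 1 in H.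
  replace (fst (brk (right_inv X) (right_inv Y) g)) with (vect_bracket (fst Y) (fst X))
    in H by (symmetry; now apply vect_ext).
  rewrite (beta_derivative_swap (fst X) (fst Y)) in H; simpl.
  pose proof PI_RGT_0 as HPI.
  apply (Rmult_eq_reg_l (4 * PI)); [|lra].
  lra.
Qed.

(** * The inner product on the Virasoro algebra *)

Lemma innerE X Y : inner X Y = int_S1 (vect_mul (fst X) (fst Y)) + snd X * snd Y.
Proof. reflexivity. Qed.

Lemma omegaE (h k : vect) :
  omega h k = int_S1 (vect_mul (vect_derive h) (vect_derive (vect_derive k))).
Proof. reflexivity. Qed.

Lemma inner_sym X Y : inner X Y = inner Y X.
Proof.
unfold inner; f_equal; [|ring]; apply int_S1_ext; intros; ring.
Qed.

Lemma inner_vadd_l X Y Z : inner (vadd X Y) Z = inner X Z + inner Y Z.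
Proof.
rewrite !innerE; cbn [fst snd vadd vscal].
rewrite (int_S1_ext _ (vect_add (vect_mul (fst X) (fst Z)) (vect_mul (fst Y) (fst Z)))).
- rewrite int_S1_add; ring.
- intros; vect_simpl; ring.
Qed.

Lemma inner_vscal_l c X Z : inner (vscal c X) Z = c * inner X Z.
Proof.
rewrite !innerE; cbn [fst snd vadd vscal].
rewrite (int_S1_ext _ (vect_scal c (vect_mul (fst X) (fst Z)))).
- rewrite int_S1_scal; ring.
- intros; vect_simpl; ring.
Qed.

Lemma inner_vsub_l X Y Z : inner (vsub X Y) Z = inner X Z - inner Y Z.
Proof. unfold vsub; rewrite inner_vadd_l, inner_vscal_l; ring. Qed.

Lemma inner_nondegenerate X Y : (forall Z, inner X Z = inner Y Z) -> X = Y.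
Proof.
intros H.
assert (H0 : inner (vsub X Y) (vsub X Y) = 0) by (rewrite inner_vsub_l, H; ring).
rewrite innerE in H0; set (d := vsub X Y) in *.
assert (Hd : forall x, 0 <= vect_mul (fst d) (fst d) x).
{ intros; rewrite vect_mulE; nra. }
assert (0 <= int_S1 (vect_mul (fst d) (fst d))).
{ apply RInt_ge_0; auto using vect_ex_RInt; pose proof two_PI_pos; lra. }
assert (Hi : int_S1 (vect_mul (fst d) (fst d)) = 0) by nra.
assert (Hs : snd d = 0) by nra.
apply vir_ext.
- intros x; pose proof (int_S1_eq0 _ Hd Hi x) as E; rewrite vect_mulE in E.
  unfold d in E; simpl in E; nra.
- unfold d in Hs; simpl in Hs; lra.
Qed.

(** * The Levi-Civita connection on right invariant fields *)

Lemma vir_bracket_skew X Y : vir_bracket X Y = vscal (-1) (vir_bracket Y X).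
Proof.
apply vir_ext.
- intros x; unfold vir_bracket, vect_bracket; simpl; ring.
- simpl; rewrite omega_skew; ring.
Qed.

(** Twice the value of the covariant derivative of the right invariant field
    [Y] along [X]. *)
Definition gamma2 (X Y : vir) : vir :=
  let (h, a) := X in let (k, b) := Y in
  (vect_add
    (vect_add (vect_scal 2 (vect_mul (vect_derive h) k))
       (vect_scal 4 (vect_mul h (vect_derive k))))
    (vect_add (vect_scal b (vect_derive (vect_derive (vect_derive h))))
       (vect_scal a (vect_derive (vect_derive (vect_derive k))))),
   - omega h k).

(** The right-hand side of Koszul's formula for right invariant fields.  The signs
    are opposite to those for left invariant fields, because the bracket of fields is
    [- vir_bracket]. *)
Definition koszul (X Y Z : vir) : R :=
  - inner (vir_bracket X Y) Z + inner (vir_bracket Y Z) X - inner (vir_bracket Z X) Y.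

(** The integrands differ by the derivative of [2hkm + bh''m + a(k''m - k'm')]. *)
Lemma gamma2_koszul X Y Z : inner (gamma2 X Y) Z = koszul X Y Z.
Proof.
destruct X as [h a], Y as [k b], Z as [m c]; unfold koszul.
rewrite !innerE; cbn [fst snd gamma2 vir_bracket]; rewrite (omegaE k m), (omegaE m h).
set (h1 := vect_derive h); set (h2 := vect_derive h1); set (h3 := vect_derive h2).
set (k1 := vect_derive k); set (k2 := vect_derive k1); set (k3 := vect_derive k2).
set (m1 := vect_derive m); set (m2 := vect_derive m1).
set (A := vect_mul (vect_add _ _) m).
set (B1 := vect_mul (vect_bracket h k) m).
set (B2 := vect_mul (vect_bracket k m) h).
set (B3 := vect_mul (vect_bracket m h) k).
rewrite (int_S1_exact A
  (vect_add (vect_add (vect_scal (-1) B1) (vect_add B2 (vect_scal (-1) B3)))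
    (vect_add (vect_scal a (vect_mul k1 m2)) (vect_scal (- b) (vect_mul m1 h2))))
  (vect_add (vect_scal 2 (vect_mul h (vect_mul k m)))
    (vect_add (vect_scal b (vect_mul h2 m))
      (vect_scal a (vect_add (vect_mul k2 m) (vect_scal (-1) (vect_mul k1 m1))))))).
- rewrite !int_S1_add, !int_S1_scal; ring.
- intros x; unfold A, B1, B2, B3, vect_bracket; vect_simpl.
  fold h1 k1 m1; fold h2 k2 m2; fold h3 k3; ring.
Qed.

Lemma koszul_skew X Y Z : koszul X Y Z = - koszul X Z Y.
Proof.
unfold koszul; rewrite (vir_bracket_skew X Y), (vir_bracket_skew Z X),
  (vir_bracket_skew Z Y), !inner_vscal_l; ring.
Qed.

(** Compatibility with the metric and vanishing torsion, each in the three cyclic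
    orders, are linear equations that determine the pairing with every [Z]. *)
Lemma right_inv_connection brk nabla X Y g :
  is_field_bracket brk -> is_levi_civita brk nabla ->
  nabla (right_inv X) (right_inv Y) g = vscal (/ 2) (gamma2 X Y).
Proof.
intros Hbrk [_ Htor Hmet].
set (T := fun X Y Z : vir => inner (nabla (right_inv X) (right_inv Y) g) Z).
assert (HT : forall X Y Z, T X Y Z + T X Z Y = 0).
{ intros X' Y' Z'; unfold T; rewrite (inner_sym _ Y').
  apply (is_dir_derive_unique (fun _ => inner Y' Z') g X').
  - apply (Hmet (right_inv X') (right_inv Y') (right_inv Z') g).
  - apply is_dir_derive_const. }
assert (HB : forall X Y Z, T X Y Z - T Y X Z = - inner (vir_bracket X Y) Z).
{ intros X' Y' Z'; unfold T; rewrite <- inner_vsub_l, Htor.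
  rewrite (bracket_right_inv _ _ _ _ Hbrk), inner_vscal_l; ring. }
apply inner_nondegenerate; intros Z.
rewrite inner_vscal_l, gamma2_koszul; unfold koszul; fold (T X Y Z).
pose proof (HT X Y Z); pose proof (HT Y Z X); pose proof (HT Z X Y).
pose proof (HB X Y Z); pose proof (HB Y Z X); pose proof (HB Z X Y).
lra.
Qed.

(** * The curvature *)

(** Moving the outer covariant derivative to the other side of the inner product
    leaves only covariant derivatives of [X] and [Y] along each other, and no
    derivatives of order above 3 under the integral. *)
Lemma curvature_gamma2 brk nabla g X Y :
  is_field_bracket brk -> is_levi_civita brk nabla ->
  inner (vscal 4 (right_triv_curvature brk nabla g X Y X)) Y =
  inner (gamma2 X X) (gamma2 Y Y) - inner (gamma2 Y X) (gamma2 X Y)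
  - 2 * koszul (vir_bracket Y X) X Y.
Proof.
intros Hbrk Hlc.
assert (EG : forall X Y, nabla (right_inv X) (right_inv Y)
                         = right_inv (vscal (/ 2) (gamma2 X Y))).
{ intros X' Y'; apply vfield_ext; intros g'.
  exact (right_inv_connection _ _ _ _ _ Hbrk Hlc). }
assert (EB : brk (right_inv X) (right_inv Y) = right_inv (vir_bracket Y X)).
{ apply vfield_ext; intros g'; rewrite (vir_bracket_skew Y X).
  exact (bracket_right_inv _ _ _ _ Hbrk). }
unfold right_triv_curvature, curvature; rewrite !EG, EB, !EG; cbn [vf right_inv].
assert (Hskew : forall X Y Z, inner (gamma2 X Y) Z = - inner Y (gamma2 X Z)).
{ intros; rewrite (inner_sym Y0), !gamma2_koszul; apply koszul_skew. }
rewrite inner_vscal_l, !inner_vsub_l, !inner_vscal_l.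
rewrite (Hskew X (vscal _ _)), (Hskew Y (vscal _ _)), !inner_vscal_l.
rewrite (gamma2_koszul (vir_bracket Y X)); field.
Qed.

(** In degree 0 in [a, b] the integrand is [-8u^2 + 4u^2] with [u] the bracket of
    [h] and [k], and in degree 2 it is [- (bh''' - ak''')^2].  Only the terms linear in
    [a, b] need integration by parts, with boundary term
    [a (-4hkk''' + 2h'kk'' - 2h''kk' + 4h'''k^2)
     + b (4h^2k''' + 2hh''k' - 2h'h''k - 4hh'''k)].
    The central parts of the two products of [gamma2] and of the middle Koszul term
    contribute [1 + 2] times [omega(h,k)^2]. *)
Lemma gamma2_curvature_integral (h k : vect) (a b : R) :
  inner (gamma2 (h, a) (h, a)) (gamma2 (k, b) (k, b))
  - inner (gamma2 (k, b) (h, a)) (gamma2 (h, a) (k, b))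
  - 2 * koszul (vir_bracket (k, b) (h, a)) (h, a) (k, b) =
  int_S1 (fun x =>
         - 4 * (bracket h k x) ^ 2
         + 4 * (a * k x - b * h x)
             * (h x * Derive_n k 4 x - Derive h x * Derive_n k 3 x
                + Derive_n h 3 x * Derive k x - Derive_n h 4 x * k x)
         - (Derive_n k 3 x) ^ 2 * a ^ 2
         + 2 * Derive_n h 3 x * Derive_n k 3 x * a * b
         - (Derive_n h 3 x) ^ 2 * b ^ 2)
       + 3 * (omega h k) ^ 2.
Proof.
assert (Ehh : omega h h = 0) by (pose proof (omega_skew h h); lra).
assert (Ekk : omega k k = 0) by (pose proof (omega_skew k k); lra).
unfold koszul; rewrite !innerE; cbn [fst snd gamma2 vir_bracket]; rewrite (omega_skew k h), Ehh, Ekk.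
set (h1 := vect_derive h); set (h2 := vect_derive h1); set (h3 := vect_derive h2);
  set (h4 := vect_derive h3).
set (k1 := vect_derive k); set (k2 := vect_derive k1); set (k3 := vect_derive k2);
  set (k4 := vect_derive k3).
set (u := vect_bracket h k).
set (W := vect_bracket k h).
set (M1 := vect_mul (vect_add _ _) (vect_add _ _)) at 1.
set (M2 := vect_mul (vect_add _ _) (vect_add _ _)).
set (M3 := vect_mul (vect_bracket W h) k).
set (M4 := vect_mul u W).
set (M5 := vect_mul (vect_bracket k W) h).
rewrite (omegaE W h), (omegaE k W).
fold h1 h2 k1.
set (N1 := vect_mul (vect_derive W) h2).
set (N2 := vect_mul k1 (vect_derive (vect_derive W))).
set (L := vect_add (vect_add M1 (vect_scal (-1) M2))
  (vect_add (vect_scal 2 (vect_add M3 (vect_add (vect_scal b N1) (vect_scal a N2))))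
    (vect_scal (-2) (vect_add M4 (vect_scal (-1) M5))))).
set (S := vect_add (vect_mul h k4) (vect_add (vect_scal (-1) (vect_mul h1 k3))
  (vect_add (vect_mul h3 k1) (vect_scal (-1) (vect_mul h4 k))))).
set (P := vect_add (vect_scal b h3) (vect_scal (- a) k3)).
set (RR := vect_add (vect_scal (-4) (vect_mul u u))
  (vect_add (vect_scal 4 (vect_mul (vect_add (vect_scal a k) (vect_scal (- b) h)) S))
     (vect_scal (-1) (vect_mul P P)))).
transitivity (int_S1 L + 3 * omega h k ^ 2).
{ unfold L; rewrite !int_S1_add, !int_S1_scal, !int_S1_add, !int_S1_scal,
    ?int_S1_add, ?int_S1_scal; ring. }
f_equal.
transitivity (int_S1 RR).
- apply (int_S1_exact L RR
   (vect_add
     (vect_scal a (vect_add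
       (vect_add (vect_scal (-4) (vect_mul h (vect_mul k k3)))
                 (vect_scal 2 (vect_mul h1 (vect_mul k k2))))
       (vect_add (vect_scal (-2) (vect_mul h2 (vect_mul k k1)))
                 (vect_scal 4 (vect_mul h3 (vect_mul k k))))))
     (vect_scal b (vect_add
       (vect_add (vect_scal 4 (vect_mul h (vect_mul h k3)))
                 (vect_scal 2 (vect_mul h (vect_mul h2 k1))))
       (vect_add (vect_scal (-2) (vect_mul h1 (vect_mul h2 k)))
                 (vect_scal (-4) (vect_mul h (vect_mul h3 k)))))))).
  intros x; unfold L, RR, M1, M2, M3, M4, M5, N1, N2, S, P, u, W, vect_bracket.
  vect_simpl.
  fold h1 k1; fold h2 k2; fold h3 k3; fold h4 k4; ring.
- apply int_S1_ext; intros x.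
  change (Derive_n h 4 x) with (h4 x); change (Derive_n k 4 x) with (k4 x).
  change (Derive_n h 3 x) with (h3 x); change (Derive_n k 3 x) with (k3 x).
  unfold bracket; change (Derive h x) with (h1 x); change (Derive k x) with (k1 x).
  unfold RR, S, P, u, vect_bracket; vect_simpl; fold h1 k1; ring.
Qed.

(** * The plane spanned by sin and cos *)

Lemma vect_derive_sin : vect_derive vect_sin = vect_cos.
Proof. apply vect_ext; intros x; apply is_derive_unique, is_derive_sin. Qed.

Lemma vect_derive_cos : vect_derive vect_cos = vect_scal (-1) vect_sin.
Proof.
apply vect_ext; intros x; rewrite vect_scalE.
transitivity (- sin x); [apply is_derive_unique, is_derive_cos|simpl; ring].
Qed.

Lemma ex_derive_vect (h : vect) x : ex_derive h x.
Proof. eexists; apply vect_is_derive. Qed.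

Lemma int_S1_antiderivative (f F : R -> R) :
  (forall x, is_derive F x (f x)) -> (forall x, ex_derive f x) ->
  int_S1 f = F (2 * PI) - F 0.
Proof.
intros HF Hf; apply is_RInt_unique, (is_RInt_derive F f).
- intros; apply HF.
- intros; now apply @ex_derive_continuous.
Qed.

Lemma curvature_sin_cos (a1 a2 : R) :
  int_S1 (fun x =>
         - 4 * (bracket vect_sin vect_cos x) ^ 2
         + 4 * (a1 * vect_cos x - a2 * vect_sin x)
             * (vect_sin x * Derive_n vect_cos 4 x
                - Derive vect_sin x * Derive_n vect_cos 3 x
                + Derive_n vect_sin 3 x * Derive vect_cos x
                - Derive_n vect_sin 4 x * vect_cos x)
         - (Derive_n vect_cos 3 x) ^ 2 * a1 ^ 2
         + 2 * Derive_n vect_sin 3 x * Derive_n vect_cos 3 x * a1 * a2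
         - (Derive_n vect_sin 3 x) ^ 2 * a2 ^ 2)
       + 3 * (omega vect_sin vect_cos) ^ 2
  = - PI * (8 + a1 ^ 2 + a2 ^ 2 - 3 * PI).
Proof.
pose proof vect_derive_sin as Ds; pose proof vect_derive_cos as Dc.
assert (D2c : vect_derive (vect_derive vect_cos) = vect_scal (-1) vect_cos).
{ now rewrite Dc, vect_derive_scal, Ds. }
assert (D3c : vect_derive (vect_derive (vect_derive vect_cos)) = vect_sin).
{ rewrite D2c, vect_derive_scal, Dc; apply vect_ext; intros x.
  rewrite !vect_scalE; ring. }
assert (Ew : omega vect_sin vect_cos = - PI).
{ rewrite omegaE, D2c, Ds.
  rewrite (int_S1_antiderivative _ (fun x => - (x + sin x * cos x) / 2)).
  - rewrite sin_2PI, sin_0; field.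
  - intros x; auto_derive; [exact I|]; vect_simpl; simpl.
    pose proof (sin2_cos2 x) as E; unfold Rsqr in E; lra.
  - apply ex_derive_vect. }
rewrite Ew.
rewrite (int_S1_ext _ (fun x => - 4 - a1 ^ 2 * sin x ^ 2 - 2 * a1 * a2 * sin x * cos x
  - a2 ^ 2 * cos x ^ 2)).
- rewrite (int_S1_antiderivative _ (fun x => - 4 * x - a1 ^ 2 * (x - sin x * cos x) / 2
    - a1 * a2 * sin x ^ 2 - a2 ^ 2 * (x + sin x * cos x) / 2)).
  + rewrite sin_2PI, sin_0; field.
  + intros x; auto_derive; [exact I|].
    assert (E : sin x * sin x = 1 - cos x * cos x)
      by (rewrite <- (sin2_cos2 x); unfold Rsqr; ring).
    field [E].
  + intros x; auto_derive; exact I.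
- intros x.
  change (Derive_n vect_sin 4 x) with
    (vect_derive (vect_derive (vect_derive (vect_derive vect_sin))) x).
  change (Derive_n vect_sin 3 x) with
    (vect_derive (vect_derive (vect_derive vect_sin)) x).
  change (Derive_n vect_cos 4 x) with
    (vect_derive (vect_derive (vect_derive (vect_derive vect_cos))) x).
  change (Derive_n vect_cos 3 x) with
    (vect_derive (vect_derive (vect_derive vect_cos)) x).
  unfold bracket; change (Derive vect_sin x) with (vect_derive vect_sin x).
  change (Derive vect_cos x) with (vect_derive vect_cos x).
  rewrite !Ds, D3c, D2c, Ds, Dc, !vect_scalE; simpl vfun.
  replace (cos x * cos x - sin x * (-1 * sin x)) with 1
    by (rewrite <- (sin2_cos2 x); unfold Rsqr; ring).
  ring.
Qed.

Theorem mainTheorem10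
  (brk nabla : vfield -> vfield -> vfield)
  (Hbrk : is_field_bracket brk)
  (Hnabla : is_levi_civita brk nabla)
  (g : VB) :
  let K (X1 X2 : vir) : R :=
    inner (vscal 4 (right_triv_curvature brk nabla g X1 X2 X1)) X2 in
  (forall (h1 h2 : vect) (a1 a2 : R),
     K (h1, a1) (h2, a2) =
       int_S1 (fun x =>
         - 4 * (bracket h1 h2 x) ^ 2
         + 4 * (a1 * h2 x - a2 * h1 x)
             * (h1 x * Derive_n h2 4 x - Derive h1 x * Derive_n h2 3 x
                + Derive_n h1 3 x * Derive h2 x - Derive_n h1 4 x * h2 x)
         - (Derive_n h2 3 x) ^ 2 * a1 ^ 2
         + 2 * Derive_n h1 3 x * Derive_n h2 3 x * a1 * a2
         - (Derive_n h1 3 x) ^ 2 * a2 ^ 2)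
       + 3 * (omega h1 h2) ^ 2)
  /\ (exists X1 X2 : vir, 0 < K X1 X2)
  /\ (exists X1 X2 : vir, K X1 X2 < 0)
  /\ (forall a1 a2 : R,
        K (vect_sin, a1) (vect_cos, a2)
        = - PI * (8 + a1 ^ 2 + a2 ^ 2 - 3 * PI)).
Proof.
intros K.
assert (HK : forall X Y, K X Y =
  inner (gamma2 X X) (gamma2 Y Y) - inner (gamma2 Y X) (gamma2 X Y)
  - 2 * koszul (vir_bracket Y X) X Y)
  by (intros; now apply curvature_gamma2).
assert (Hsc : forall a1 a2 : R, K (vect_sin, a1) (vect_cos, a2)
        = - PI * (8 + a1 ^ 2 + a2 ^ 2 - 3 * PI)).
{ intros a1 a2; rewrite HK, gamma2_curvature_integral; apply curvature_sin_cos. }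
pose proof PI2_3_2; pose proof PI_4.
split; [intros; rewrite HK; apply gamma2_curvature_integral|split; [|split; [|exact Hsc]]].
- exists (vect_sin, 0), (vect_cos, 0); rewrite Hsc; nra.
- exists (vect_sin, 3), (vect_cos, 0); rewrite Hsc; nra.
Qed.
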